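(* Let $(\mathcal{X},d)$ be a compact metric space and $T:\mathcal{X}\to\mathcal{X}$ a continuous map. Then $$\overline{mdim}(\mathcal{X},d,T)=\lim_{\delta\to 0}\limsup_{\epsilon\to 0}\frac{\sup_{\mu\in\mathcal{M}_T(\mathcal{X})}h_\mu(\epsilon,T,\delta)}{|\log\epsilon|}.$$
   Context: For $n\ge 1$ let $d_n(x,y)=\max_{0\le k\le n-1}d(T^kx,T^ky)$. An $(n,\epsilon)$-dynamical ball is a ball of radius $\epsilon$ in the metric $d_n$. A set $E\subset\mathcal{X}$ is $(n,\epsilon)$-separated if $d_n(x,y)>\epsilon$ for all distinct $x,y\in E$. $N_d(n,\epsilon)$ is the maximal cardinality of an $(n,\epsilon)$-separated subset of $\mathcal{X}$, and $S(\mathcal{X},d,\epsilon)=\limsup_{n\to\infty}\frac1n\log N_d(n,\epsilon)$. The upper metric mean dimension is $$\overline{mdim}(\mathcal{X},d,T)=\limsup_{\epsilon\to 0}\frac{S(\mathcal{X},d,\epsilon)}{|\log\epsilon|}.$$ $\mathcal{M}_T(\mathcal{X})$ is the set of $T$-invariant Borel probability measures on $\mathcal{X}$. For $\mu\in\mathcal{M}_T(\mathcal{X})$, $\delta\in(0,1)$, $n\in\mathbb{N}$ and $\epsilon>0$, $N_\mu(n,\epsilon,\delta)$ is the minimum number of $(n,\epsilon)$-dynamical balls needed to cover a set of $\mu$-measure strictly bigger than $1-\delta$, and $h_\mu(\epsilon,T,\delta)=\limsup_{n\to\infty}\frac1n\log N_\mu(n,\epsilon,\delta)$. *)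

(* Defs.v *)
From HB Require Import structures.
From mathcomp Require Import all_boot all_order all_algebra.
From mathcomp Require Import all_classical all_reals all_analysis.

Set Implicit Arguments.
Unset Strict Implicit.
Unset Printing Implicit Defensive.

Import Order.TTheory GRing.Theory Num.Theory.
Import numFieldNormedType.Exports.

Local Open Scope classical_set_scope.
Local Open Scope ring_scope.
Local Open Scope ereal_scope.

(* [measurableType]s are pointed, so Borel measures are set up on nonempty
   metric spaces; the distinguished point plays no other role. *)
#[short(type="pmetricType")]
HB.structure Definition PointedMetric (K : numDomainType) :=
  {M of Pointed M & Metric K M}.

Definition borel (R : realType) (X : pmetricType R) :=
  g_sigma_algebraType (@open X).

(* For [n = 0] this is the zero function; that case does not affect the
   limits superior in [n] below. *)
Definition bowen_dist (R : realType) (X : pmetricType R) (T : X -> X) (n : nat)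
    (x y : X) : R :=
  (\big[Num.max/0]_(k < n) mdist (iter k T x) (iter k T y))%R.

Definition dyn_ball (R : realType) (X : pmetricType R) (T : X -> X) (n : nat)
    (e : R) (x : X) : set X :=
  [set y | (bowen_dist T n x y < e)%R].

Definition separated (R : realType) (X : pmetricType R) (T : X -> X) (n : nat)
    (e : R) (E : set X) : Prop :=
  forall x y, E x -> E y -> x <> y -> (e < bowen_dist T n x y)%R.

Definition sep_number (R : realType) (X : pmetricType R) (T : X -> X) (n : nat)
    (e : R) : \bar R :=
  ereal_sup [set counting E | E in separated T n e].

Definition sep_growth (R : realType) (X : pmetricType R) (T : X -> X)
    (e : R) : \bar R :=
  limn_esup (fun n => (n%:R^-1)%:E * lne (sep_number T n e)).

Definition umdim (R : realType) (X : pmetricType R) (T : X -> X) : \bar R :=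
  limf_esup (fun e : R => sep_growth T e / `|ln e|%:E) 0^'+.

Definition invariant_prob (R : realType) (X : pmetricType R) (T : X -> X) :
    set (probability (borel X) R) :=
  [set mu : probability (borel X) R |
    forall A : set (borel X), measurable A -> mu (T @^-1` A) = mu A].

(* The infimum is over sets [F] of centers; as [counting] takes values in the
   natural numbers and [+oo], it is a minimum. *)
Definition cover_number (R : realType) (X : pmetricType R) (T : X -> X)
    (mu : probability (borel X) R) (n : nat) (e delta : R) : \bar R :=
  ereal_inf [set counting F | F in [set F : set X |
    exists A : set (borel X), [/\ measurable A, (1 - delta)%:E < mu A &
      A `<=` \bigcup_(x in F) dyn_ball T n e x]]].

Definition katok_entropy (R : realType) (X : pmetricType R) (T : X -> X)
    (mu : probability (borel X) R) (e delta : R) : \bar R :=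
  limn_esup (fun n => (n%:R^-1)%:E * lne (cover_number T mu n e delta)).

(* Main.v *)
Require Import Defs.
From HB Require Import structures.
From mathcomp Require Import all_boot all_order all_algebra.
From mathcomp Require Import finmap.
From mathcomp Require Import all_classical all_reals all_analysis.
From mathcomp Require Import ring lra zify.
Set Implicit Arguments.
Unset Strict Implicit.
Unset Printing Implicit Defensive.
Import Order.TTheory GRing.Theory Num.Theory.
Import numFieldNormedType.Exports.
Local Open Scope classical_set_scope.
Local Open Scope ring_scope.
Local Open Scope ereal_scope.

(** Write [S(e)] for [sep_growth T e] and [h(e, delta)] for the supremum of
    [katok_entropy T mu e delta] over the invariant probabilities [mu]. The
    theorem follows from
      [(1 - 2 delta) S(4 e) <= h(e, delta) <= S(e / 2)]   for [delta < 1/2]: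
    replacing [e] by a fixed multiple of [e] does not change a limit superior
    of quotients by [|ln e|] ([limf_esup_ln_scale]), so that the limit superior
    for [delta] lies between [(1 - 2 delta) umdim T] and [umdim T], and both
    tend to [umdim T], finite or not.

    The upper bound holds measure by measure: a maximal [(n, e/2)]-separated
    set is a set of centers of [(n, e)]-balls that cover the whole space.

    For the lower bound, cover [X] by finitely many open balls [V i] of radius
    [2 e] in such a way that every ball of radius [e] lies in one of them. A
    word [w] over the index set defines the cylinder of the points whose orbit
    visits the sets [V (w_k)] in turn. Let [N_n] be the least number of words of
    length [n] whose cylinders cover [X], and [t] the exponential growth rate of
    [N_n]. Two points of one cylinder are [4 e]-close along their orbits, hence
    [S(4 e) <= t]. An invariant measure [mu] with
    [katok_entropy T mu e delta] at least about [(1 - 2 delta) t] is obtained from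
    three ingredients.

    - [spread_set]: since the greedy algorithm does not cover [X] with fewer
      than [N_n] cylinders, it gets stuck at a finite set [Y_n] such that a
      single cylinder holds at most a proportion [poly(n) / N_n] of its points.
    - [empirical_limit]: along an ultrafilter, the empirical measures of [Y_n]
      tend to a finitely additive invariant probability, and the regularization
      of the latter is an invariant Borel probability [mu] giving to open sets
      no more mass than the limit does.
    - [word_num_coding]: let [mu] give more than [1 - delta] to a union [U] of
      [K] cylinders of length [m]. Then for suitable large [n] half of the
      points of [Y_n] spend at most a proportion [2 delta] of the times before
      [n] outside [U]. Cutting their orbits into blocks of length [m], all but
      a proportion [2 delta] of the blocks are described by one of the [K]
      words, the others by one of the [N_m] words of an optimal cover, so that
      the number of words needed for these points is about
      [2 ^ (n / m) * K ^ (n / m) * N_m ^ (2 delta n / m)]. As [Y_n] is spread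
      out, [N_n] is not much larger, hence
      [t <= (ln 2) / m + (ln K) / m + 2 delta t] up to small errors.

    Counting cylinders instead of separated points is what makes the same rate
    [t] appear on both sides. With separated points alone, the orbit pieces
    outside [U] would have to be described at a finer scale [e'], and the
    resulting bound [S(e) <= h(e', delta) + 2 delta S(e')] is not sufficient when the
    mean dimension is infinite. *)

(** * Borel regularization of a finitely additive probability *)

Record fin_additive_prob (R : realType) (X : Type) (L : set X -> R) : Prop := {
  fap_ge0 : forall A, (0 <= L A)%R;
  fap_setT : L setT = 1%R;
  fap_setU : forall A B, A `&` B = set0 -> L (A `|` B) = (L A + L B)%R }.

Section fin_additive.
Variables (R : realType) (X : Type) (L : set X -> R).
Hypothesis hL : fin_additive_prob L.

Lemma fap_set0 : L set0 = 0%R.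
Proof.
have := fap_setU hL (set0I (@set0 X)); rewrite setU0 => /eqP.
by rewrite -subr_eq0 opprD addNKr oppr_eq0 => /eqP.
Qed.

Lemma le_fap A B : A `<=` B -> (L A <= L B)%R.
Proof.
move=> AB; rewrite -(setDUK AB) fap_setU ?setDIK// lerDl.
exact: (fap_ge0 hL).
Qed.

Lemma fap_setU_le A B : (L (A `|` B) <= L A + L B)%R.
Proof.
rewrite -[A `|` B](setDUK (@subsetUl _ A B)) fap_setU ?setDIK// lerD2l.
by apply: le_fap => x [[Ax|//]]; move=> /(_ Ax).
Qed.

End fin_additive.

Section regularization.
Variables (R : realType) (X : pmetricType R) (L : set X -> R).
Hypothesis cX : compact [set: X].
Hypothesis hL : fin_additive_prob L.

(** The finitely additive [L] need not be countably additive on open sets; the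
    inner regular version is, by compactness. *)
Definition inner_content (U : set X) : \bar R :=
  ereal_sup [set (L C)%:E | C in [set C | closed C /\ C `<=` U]].

Definition outer_content (A : set X) : \bar R :=
  ereal_inf [set inner_content U | U in [set U | open U /\ A `<=` U]].

Lemma inner_content_ge (U C : set X) :
  closed C -> C `<=` U -> (L C)%:E <= inner_content U.
Proof. by move=> cC CU; apply: ereal_sup_ubound; exists C. Qed.

Lemma inner_content_le (U : set X) : inner_content U <= (L U)%:E.
Proof. by apply: ge_ereal_sup => _ [C [cC CU] <-]; rewrite lee_fin le_fap. Qed.

Lemma inner_content_ge0 (U : set X) : 0 <= inner_content U.
Proof.
apply: (@le_trans _ _ (L set0)%:E); first by rewrite lee_fin (fap_ge0 hL).
by apply: inner_content_ge; [exact: closed0|exact: sub0set].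
Qed.

Lemma inner_content_le1 (U : set X) : inner_content U <= 1.
Proof.
apply: le_trans (inner_content_le U) _.
by rewrite lee_fin -(fap_setT hL) le_fap.
Qed.

Lemma le_inner_content (U V : set X) :
  U `<=` V -> inner_content U <= inner_content V.
Proof.
move=> UV; apply: ge_ereal_sup => _ [C [cC CU] <-].
exact: inner_content_ge (subset_trans CU UV).
Qed.

Lemma inner_contentT : inner_content setT = 1.
Proof.
apply/eqP; rewrite eq_le inner_content_le1/= -(fap_setT hL).
exact: inner_content_ge (@closedT _) _.
Qed.

Lemma outer_content_le (A U : set X) :
  open U -> A `<=` U -> outer_content A <= inner_content U.
Proof. by move=> oU AU; apply: ereal_inf_lbound; exists U. Qed.

Lemma outer_content_open (U : set X) :
  open U -> outer_content U = inner_content U.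
Proof.
move=> oU; apply/eqP; rewrite eq_le outer_content_le//=.
by apply: le_ereal_inf_tmp => _ [V [_ UV] <-]; exact: le_inner_content.
Qed.

Lemma outer_content_ge0 (A : set X) : 0 <= outer_content A.
Proof.
by apply: le_ereal_inf_tmp => _ [V _ <-]; exact: inner_content_ge0.
Qed.

Lemma outer_content_le1 (A : set X) : outer_content A <= 1.
Proof. by rewrite -inner_contentT outer_content_le//; exact: openT. Qed.

Lemma outer_content_fin_num (A : set X) : outer_content A \is a fin_num.
Proof.
rewrite ge0_fin_numE ?outer_content_ge0//.
by apply: le_lt_trans (outer_content_le1 A) _; rewrite ltey.
Qed.

Lemma le_outer_content (A B : set X) :
  A `<=` B -> outer_content A <= outer_content B.
Proof.
move=> AB; apply: le_ereal_inf_tmp => _ [V [oV BV] <-].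
exact: outer_content_le (subset_trans AB BV).
Qed.

Lemma outer_content0 : outer_content set0 = 0.
Proof.
rewrite outer_content_open; last exact: open0.
apply/eqP; rewrite eq_le inner_content_ge0 andbT.
by apply: le_trans (inner_content_le _) _; rewrite (fap_set0 hL).
Qed.

Lemma outer_content_adherent (A : set X) (e : R) : (0 < e)%R ->
  exists U, [/\ open U, A `<=` U & inner_content U <= outer_content A + e%:E].
Proof.
move=> e0; have [_ [U [oU AU] <-] lU] :=
  lb_ereal_inf_adherent e0 (outer_content_fin_num A).
by exists U; split => //; exact: ltW.
Qed.

Lemma inner_content_adherent (U : set X) (e : R) : (0 < e)%R ->
  exists C, [/\ closed C, C `<=` U & inner_content U <= (L C + e)%:E].
Proof.
move=> e0.
have fU : inner_content U \is a fin_num.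
  rewrite ge0_fin_numE ?inner_content_ge0//.
  by apply: le_lt_trans (inner_content_le1 U) _; rewrite ltey.
have [_ [C [cC CU] <-] /ltW lC] := ub_ereal_sup_adherent e0 fU.
by exists C; split => //; rewrite EFinD -leeBlDr.
Qed.

(** By normality, a closed set covered by two open sets is the union of two
    closed sets, one inside each of them. *)
Lemma inner_contentU (U V : set X) : open U -> open V ->
  inner_content (U `|` V) <= inner_content U + inner_content V.
Proof.
move=> oU oV; apply: ge_ereal_sup => _ [C [cC CUV] <-].
have cCV : closed (C `\` V) by apply: closedI => //; exact: open_closedC.
have cCU : closed (C `\` U) by apply: closedI => //; exact: open_closedC.
have CVU0 : (C `\` V) `&` (C `\` U) = set0.
  by apply/seteqP; split=> // x [[Cx nV] [_ nU]]; case: (CUV x Cx).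
have /(@normal_openP R X) nX := @pseudometric_normal R X.
have [U' [V' [oU' oV' sU' sV' dUV]]] := nX _ _ cCV cCU CVU0.
have -> : C = (C `\` V') `|` (C `\` U').
  apply/seteqP; split => [x Cx|x [[]|[]]//].
  have [xU'|] := pselect (U' x); last by right.
  by left; split=> // xV'; have : (U' `&` V') x by []; rewrite dUV.
apply: (@le_trans _ _ ((L (C `\` V'))%:E + (L (C `\` U'))%:E)).
  by rewrite -EFinD lee_fin fap_setU_le.
apply: leeD; apply: inner_content_ge.
- by apply: closedI => //; exact: open_closedC.
- by move=> x [Cx nV']; apply: contrapT => nU; apply: nV'; apply: sV'.
- by apply: closedI => //; exact: open_closedC.
- by move=> x [Cx nU']; apply: contrapT => nV; apply: nU'; apply: sU'.
Qed.

Lemma inner_content_bigsetU (U : (set X)^nat) n : (forall i, open (U i)) ->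
  inner_content (\big[setU/set0]_(i < n) U i) <= \sum_(i < n) inner_content (U i).
Proof.
move=> oU; elim: n => [|n ih].
  by rewrite !big_ord0 -(outer_content_open open0) outer_content0.
rewrite !big_ord_recr/=; apply: (le_trans (inner_contentU _ _)) => //.
  by rewrite -bigcup_mkord; apply: bigcup_open.
exact: leeD2r.
Qed.

(** A closed set inside the union is compact, hence already covered by finitely
    many of the open sets. *)
Lemma inner_content_bigcup (U : (set X)^nat) : (forall i, open (U i)) ->
  inner_content (\bigcup_i U i) <= \sum_(i <oo) inner_content (U i).
Proof.
move=> oU; apply: ge_ereal_sup => _ [C [cC CU] <-].
have /compact_near_coveringP kC : compact C.
  exact: subclosed_compact cC cX _.
have [|n _ /(_ n (leqnn n)) Cn] := kC nat \oo (fun n x => exists2 i, (i < n)%N & U i x) _.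
  move=> x /CU[i _ Uix].
  exists (U i, [set n | (i < n)%N]) => /=.
    by split; [exact: open_nbhs_nbhs|exists i.+1].
  by move=> [y m] /= [Uiy im]; exists i.
apply: (@le_trans _ _ (\sum_(i < n) inner_content (U i))).
  apply: le_trans (inner_content_bigsetU n oU).
  apply: inner_content_ge => // x Cx.
  by have [i iN Uix] := Cn x Cx; rewrite -bigcup_mkord; exists i.
rewrite -(big_mkord xpredT (inner_content \o U)).
by apply: nneseries_lim_ge => i _ _; exact: inner_content_ge0.
Qed.

Lemma outer_content_sigma_subadditive : sigma_subadditive outer_content.
Proof.
move=> A; apply/lee_addgt0Pr => e e0.
apply: le_trans (epsilon_trick _ (fun n => outer_content_ge0 (A n)) (ltW e0)).
have /choice[U hU] : forall n, exists V : set X, [/\ open V, A n `<=` V &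
    inner_content V <= outer_content (A n) + (e / (2 ^ n.+1)%:R)%:E].
  move=> n; apply: outer_content_adherent.
  by rewrite divr_gt0// ltr0n expn_gt0.
have oU i : open (U i) by case: (hU i).
apply: (@le_trans _ _ (\sum_(i <oo) inner_content (U i))); last first.
  apply: lee_nneseries => [i _ _|i _]; first exact: inner_content_ge0.
  by case: (hU i).
apply: le_trans (inner_content_bigcup oU); apply: outer_content_le.
  exact: bigcup_open.
by apply: subset_bigcup => i _; case: (hU i).
Qed.

HB.instance Definition _ := isOuterMeasure.Build R X outer_content
  outer_content0 outer_content_ge0 le_outer_content
  outer_content_sigma_subadditive.

(** For [V] open, a closed [C] that nearly exhausts [V `&` U] and a closed [D]
    that nearly exhausts [V `\` C] are disjoint, so that [L] adds up on them. *)
Lemma open_caratheodory (U : set X) :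
  open U -> (outer_content : set X -> \bar R).-caratheodory U.
Proof.
move=> oU; apply: le_caratheodory_measurable => Y.
apply: le_ereal_inf_tmp => _ [V [oV YV] <-].
apply/lee_addgt0Pr => e e0.
have e20 : (0 < e / 2)%R by rewrite divr_gt0.
have [C [cC CVU hC]] := inner_content_adherent (V `&` U) e20.
have [D [cD DVC hD]] := inner_content_adherent (V `\` C) e20.
have CD0 : C `&` D = set0.
  by apply/seteqP; split => // x [Cx] /DVC[].
apply: (@le_trans _ _ (inner_content (V `&` U) + inner_content (V `\` C))).
  apply: leeD; apply: outer_content_le.
  - exact: openI.
  - exact: setSI.
  - by apply: openI => //; exact: closed_openC.
  - by move=> x [Yx nU]; split; [exact: YV|move=> /CVU[]].
apply: (@le_trans _ _ ((L C + e / 2)%:E + (L D + e / 2)%:E)).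
  exact: leeD.
rewrite -EFinD addrACA -splitr -(fap_setU hL CD0) EFinD leeD2r//.
apply: inner_content_ge; first exact: closedU.
by move=> x [/CVU[]|/DVC[]].
Qed.

Lemma borel_caratheodory (A : set (borel X)) :
  measurable A -> (outer_content : set X -> \bar R).-caratheodory A.
Proof.
move=> mA; apply: (mA (fun A => (outer_content : set X -> \bar R).-caratheodory A)).
split; last by move=> U oU; exact: open_caratheodory.
split.
- exact: caratheodory_measurable_set0.
- by move=> B mB; rewrite setTD; exact: caratheodory_measurable_setC.
- by move=> F mF; exact: caratheodory_measurable_bigcup.
Qed.

Let m : set (borel X) -> \bar R := outer_content.

Let m_sigma_additive : semi_sigma_additive m.
Proof.
move=> F mF tF mUF.
apply: (@caratheodory_measure_sigma_additive R X outer_content) => //.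
- by move=> i; exact: borel_caratheodory.
- exact: borel_caratheodory.
Qed.

HB.instance Definition _ := isMeasure.Build _ (borel X) R m
  outer_content0 outer_content_ge0 m_sigma_additive.

Let m_setT : m setT = 1.
Proof. by rewrite /m outer_content_open ?inner_contentT//; exact: openT. Qed.

HB.instance Definition _ := Measure_isProbability.Build _ (borel X) R m m_setT.

(** The Borel probability attached to [L]: on open sets it is the supremum of
    [L] over the closed subsets, hence at most [L]. *)
Definition regularization : probability (borel X) R := m.

Lemma regularizationE (A : set X) : regularization A = outer_content A.
Proof. by []. Qed.

End regularization.

(** * Empirical measures and their ultralimits *)

Section empirical.
Variables (R : realType) (X : Type) (T : X -> X).

Definition visits (n : nat) (A : set X) (y : X) : nat :=
  (\sum_(k < n) `[< A (iter k T y) >])%N.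

(** The average over [y] in [Y] and [k < n] of the Dirac masses at [T^k y],
    on all sets. *)
Definition empirical (Y : seq X) (n : nat) (A : set X) : R :=
  ((\sum_(y <- Y) visits n A y)%:R / (n * size Y)%:R)%R.

Lemma visitsT n y : visits n setT y = n.
Proof.
rewrite -[RHS]card_ord -sum1_card; apply: eq_bigr => k _.
by rewrite asboolT.
Qed.

Lemma visitsU n A B y : A `&` B = set0 ->
  visits n (A `|` B) y = (visits n A y + visits n B y)%N.
Proof.
move=> AB; rewrite /visits -big_split/=; apply: eq_bigr => k _.
rewrite asbool_or; set x := iter k T y.
case: (asboolP (A x)) => Ax; case: (asboolP (B x)) => Bx //.
by have : (A `&` B) x by []; rewrite AB.
Qed.

Lemma visitsS n A y :
  (visits n (T @^-1` A) y + `[< A y >] = visits n A y + `[< A (iter n T y) >])%N.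
Proof.
transitivity (visits n.+1 A y); last by rewrite /visits big_ord_recr.
by rewrite addnC /visits big_ord_recl.
Qed.

Lemma empirical_prob Y n : (0 < n)%N -> (0 < size Y)%N ->
  fin_additive_prob (empirical Y n).
Proof.
move=> n0 Y0; have d0 : ((n * size Y)%:R != 0 :> R)%R.
  by rewrite pnatr_eq0 muln_eq0 negb_or -!lt0n n0.
split.
- by move=> A; rewrite divr_ge0.
- rewrite /empirical (eq_bigr (fun=> n)) => [|y _]; last exact: visitsT.
  by rewrite big_const_seq count_predT iter_addn_0 divff.
- move=> A B AB; rewrite /empirical -mulrDl -natrD -big_split/=.
  by congr (_%:R / _)%R; apply: eq_bigr => y _; exact: visitsU.
Qed.

(** The visits to [A] and to its preimage differ only by the first and the last
    point of the orbit. *)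
Lemma empirical_preimage Y n A : (0 < n)%N -> (0 < size Y)%N ->
  (`|empirical Y n (T @^-1` A) - empirical Y n A| <= n%:R^-1)%R.
Proof.
move=> n0 Y0.
have H (z : nat) y : (`|(visits n (T @^-1` A) y)%:R - (visits n A y)%:R| <= 1 :> R)%R.
  have := congr1 (fun k => k%:R : R)%R (visitsS n A y).
  rewrite !natrD ler_norml.
  by case: `[< _ >]; case: `[< _ >] => /= e; apply/andP; split; lra.
rewrite /empirical -mulrBl normrM !natr_sum -sumrB.
rewrite [X in (_ * X)%R]ger0_norm ?invr_ge0//.
rewrite ler_pdivrMr ?ltr0n ?muln_gt0 ?n0// natrM mulKf ?pnatr_eq0 -?lt0n//.
apply: (le_trans (ler_norm_sum _ _ _)).
apply: (@le_trans _ _ (\sum_(y <- Y) 1)%R).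
  by apply: ler_sum => y _; exact: H.
by rewrite big_const_seq count_predT iter_addr_0.
Qed.

End empirical.

Section ultralimit.
Variables (R : realType) (X : Type) (G : set_system nat).
Hypothesis uG : UltraFilter G.
Variable P : nat -> set X -> R.
Hypothesis hP : \forall n \near G, fin_additive_prob (P n).

(** All sets are treated at once, which sequential compactness would not allow:
    along an ultrafilter every sequence in [0, 1] converges. *)
Lemma ultralimit_fin_additive :
  exists L, fin_additive_prob L /\ forall A, P n A @[n --> G] --> L A.
Proof.
have cvgP A : exists l : R, P n A @[n --> G] --> l.
  have : compact `[0%R, 1%R : R] by exact: segment_compact.
  rewrite compact_ultra => /(_ (P n A @[n --> G])) [].
  - split; first exact: fmap_proper_filter.
    move=> H pH sGH; apply/seteqP; split => // B HB.
    have [//|GB] := in_ultra_setVsetC ((P^~ A) @^-1` B) uG.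
    have HnB : H (~` B) by exact: sGH.
    have : H (B `&` ~` B) by exact: filterI.
    by rewrite setICr => /filter_not_empty.
  - apply: filterS hP => n hn /=.
    by rewrite in_itv/= (fap_ge0 hn) -(fap_setT hn) le_fap.
  by move=> l [_ ?]; exists l.
have [L hL] := choice cvgP.
exists L; split => //; split.
- move=> A; apply: cvgr_to_ge (hL A) _.
  by apply: filterS hP => n hn; exact: (fap_ge0 hn).
- apply: (cvg_unique _ (hL setT)) => //.
  apply: cvg_near_cst; apply: filterS hP => n hn.
  by rewrite (fap_setT hn).
- move=> A B AB; apply: (cvg_unique _ (hL (A `|` B))) => //.
  apply: cvg_trans (cvgD (hL A) (hL B)).
  apply: near_eq_cvg; apply: filterS hP => n hn.
  by rewrite (fap_setU hn).
Qed.

End ultralimit.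

(** * Invariance of the limit measure *)

Lemma measurable_preimage_continuous (R : realType) (X : pmetricType R)
    (T : X -> X) (A : set (borel X)) :
  continuous T -> measurable A -> measurable (T @^-1` A : set (borel X)).
Proof.
move=> cT mA; apply: (mA (fun A => measurable (T @^-1` A : set (borel X)))).
split; last first.
  move=> U oU; apply: sub_sigma_algebra. exact: (proj1 (continuousP _) cT).
split.
- by rewrite preimage_set0; exact: measurable0.
- by move=> B mB; rewrite setTD preimage_setC; exact: measurableC.
- by move=> F mF; rewrite preimage_bigcup; exact: bigcup_measurable.
Qed.

Section invariant_regularization.
Variables (R : realType) (X : pmetricType R) (T : X -> X) (L : set X -> R).
Hypothesis cX : compact [set: X].
Hypothesis cT : continuous T.
Hypothesis hL : fin_additive_prob L.
Hypothesis LT : forall A, L (T @^-1` A) = L A.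

(** A closed subset [C] of the preimage has a compact image inside [U], and the
    preimage of that image contains [C]. *)
Lemma inner_content_preimage (U : set X) : open U ->
  inner_content L (T @^-1` U) <= inner_content L U.
Proof.
move=> oU; apply: ge_ereal_sup => _ [C [cC CU] <-].
have kTC : compact (T @` C).
  apply: continuous_compact.
    by apply: continuous_subspaceT => x; exact: cT.
  exact: subclosed_compact cC cX _.
apply: (@le_trans _ _ (L (T @` C))%:E).
  by rewrite lee_fin -(LT (T @` C)); apply: le_fap => // x Cx; exists x.
apply: inner_content_ge => //.
  by apply: compact_closed kTC; exact: metric_hausdorff.
by move=> _ [x Cx <-]; exact: CU.
Qed.

(** Outer approximation by open sets gives the inequality for each Borel set;
    applied to the complement, it gives the converse. *)
Lemma regularization_invariant : invariant_prob T (regularization cX hL).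
Proof.
have le1 (A : set (borel X)) : measurable A ->
    regularization cX hL (T @^-1` A) <= regularization cX hL A.
  move=> mA; rewrite !regularizationE.
  apply: le_ereal_inf_tmp => _ [U [oU AU] <-].
  apply: le_trans (inner_content_preimage oU).
  apply: outer_content_le; last by move=> x; exact: AU.
  exact: (proj1 (continuousP _) cT).
move=> A mA; apply/eqP; rewrite eq_le; apply/andP; split; first exact: le1.
have mTA := measurable_preimage_continuous cT mA.
have := le1 _ (measurableC mA).
rewrite preimage_setC !probability_setC//.
have fA := fin_num_measure (regularization cX hL) _ mA.
have fTA := fin_num_measure (regularization cX hL) _ mTA.
by rewrite -(fineK fA) -(fineK fTA) -!EFinB !lee_fin lerD2l lerN2.
Qed.

End invariant_regularization.

Section invariant_limit.
Variables (R : realType) (X : pmetricType R) (T : X -> X).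
Hypothesis cX : compact [set: X].
Hypothesis cT : continuous T.

(** One half of the portmanteau theorem, for a cluster point along [F] of the
    empirical measures: the only property of weak limits needed for coding. *)
Lemma empirical_limit (Y : nat -> seq X) (F : set_system nat) :
  ProperFilter F -> \oo `<=` F -> (forall n, (0 < size (Y n))%N) ->
  exists mu, invariant_prob T mu /\
    forall (U : set X) (c : R) (A : set nat), open U -> c%:E < mu U -> F A ->
      exists2 n, A n & (c < empirical R T (Y n) n U)%R.
Proof.
move=> pF ooF Y0; have [G [uG FG]] := ultraFilterLemma pF.
have pos : \forall n \near G, (0 < n)%N.
  by apply/FG/ooF; exact: nbhs_infty_gt.
have hE : \forall n \near G, fin_additive_prob (empirical R T (Y n) n).
  by apply: filterS pos => n n0; exact: empirical_prob.
have [L [hL cvgL]] := ultralimit_fin_additive uG hE.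
have LT A : L (T @^-1` A) = L A.
  apply/eqP; rewrite -subr_eq0 -normr_eq0 eq_le normr_ge0 andbT.
  have cvgn : ((n%:R : R)^-1)%R @[n --> G] --> (0 : R)%R.
    apply: (@cvg_trans _ (((n%:R : R)^-1)%R @[n --> \oo])).
      by move=> B HB; apply/FG/ooF.
    rewrite -(@cvg_shiftS _ (fun n => (n%:R : R)^-1)%R); exact: cvg_harmonic.
  apply: ler_cvg_to (cvg_norm (cvgB (cvgL (T @^-1` A)) (cvgL A))) cvgn _.
  apply: filterS pos => n n0.
  exact: empirical_preimage.
exists (regularization cX hL); split; first exact: regularization_invariant.
move=> U c A oU; rewrite regularizationE outer_content_open// => cU FA.
have cL : (c < L U)%R.
  by rewrite -lte_fin (lt_le_trans cU)// inner_content_le.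
have [n [An cn]] : exists n, A n /\ (c < empirical R T (Y n) n U)%R.
  apply: (@filter_ex _ G); apply: filterI; first exact: FG.
  exact: (cvgr_gt _ (cvgL U) _ cL).
by exists n.
Qed.

End invariant_limit.

(** * Cylinders of words and spread sets *)

Section cylinders.
Variables (X : Type) (T : X -> X) (I : finType) (V : I -> set X).

Fixpoint cyl (w : seq I) : set X :=
  if w is i :: w' then V i `&` (T @^-1` cyl w') else setT.

Lemma cyl_cat u v x : cyl (u ++ v) x <-> cyl u x /\ cyl v (iter (size u) T x).
Proof.
elim: u x => [|i u ih] x /=; first by split=> [|[]].
by rewrite -iterS iterSr; split => [[Vx /ih[]]|[[Vx ux] vx]] //; split => //; apply/ih.
Qed.

Lemma cyl_take n w x : cyl w x -> cyl (take n w) x.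
Proof. by rewrite -{1}(cat_take_drop n w) => /cyl_cat[]. Qed.

Lemma cyl_nth i0 w x :
  cyl w x <-> forall k, (k < size w)%N -> V (nth i0 w k) (iter k T x).
Proof.
elim: w x => [|i w ih] x /=; first by split.
split => [[Vx /ih wx] [|k] //= kw|h].
  by rewrite -iterS iterSr; exact: wx.
split; first exact: (h 0%N).
by apply/ih => k kw; rewrite -iterSr; exact: (h k.+1).
Qed.

Definition word_cover (n : nat) (W : seq (seq I)) : Prop :=
  (forall w, w \in W -> size w = n) /\
  forall x, exists2 w, w \in W & cyl w x.

Definition words (n : nat) : seq (seq I) := [seq tval t | t : n.-tuple I].

Lemma size_words n : size (words n) = (#|I| ^ n)%N.
Proof. by rewrite size_map -cardE card_tuple. Qed.

Lemma mem_words w : w \in words (size w).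
Proof. by apply/mapP; exists (in_tuple w); rewrite ?mem_enum. Qed.

Hypothesis hV : forall x, exists i, V i x.

Lemma words_cover n : word_cover n (words n).
Proof.
split; first by move=> w /mapP[t _ ->]; rewrite size_tuple.
elim: n => [|n ih] x; first by exists [::] => //; exact: (mem_words [::]).
have [i Vx] := hV x; have [w wn wx] := ih (T x).
exists (i :: w) => //.
move: wn => /mapP[t _ ->]; rewrite -{2}(size_tuple t).
exact: (mem_words (i :: t)).
Qed.

Lemma ex_word_cover n :
  exists k, `[< exists2 W, word_cover n W & size W = k >].
Proof.
by exists (size (words n)); apply/asboolP; exists (words n) => //; exact: words_cover.
Qed.

Definition word_num (n : nat) : nat := ex_minn (ex_word_cover n).

Lemma word_num_cover n : exists2 W, word_cover n W & size W = word_num n.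
Proof. by rewrite /word_num; case: ex_minnP => k /asboolP. Qed.

Lemma word_num_le n W : word_cover n W -> (word_num n <= size W)%N.
Proof.
move=> cW; rewrite /word_num; case: ex_minnP => k _; apply.
by apply/asboolP; exists W.
Qed.

Lemma word_num_le_exp n : (word_num n <= #|I| ^ n)%N.
Proof. by rewrite -size_words word_num_le//; exact: words_cover. Qed.

Lemma word_num_gt0 n (x : X) : (0 < word_num n)%N.
Proof.
have [W [_ /(_ x)[w wW _]] <-] := word_num_cover n.
by case: W wW.
Qed.

End cylinders.

Section greedy.
Variables (R : realType) (A : finType) (W : eqType) (B : W -> {set A}).
Local Open Scope ring_scope.

(** At each step some [B w] contains more than a proportion [1 / P] of what is
    left, so that after [j] steps at most [#|S| * exp (- j / P)] elements, that
    is to say none, are left. *)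
Lemma greedy_cover (S : {set A}) (P : R) (j : nat) : 0 < P ->
  (forall Y : {set A}, Y \subset S -> Y != finset.set0 ->
     exists w, #|Y|%:R < P * #|Y :&: B w|%:R) ->
  #|S|%:R < expR (j%:R / P) ->
  exists2 s : seq W, (size s <= j)%N & forall a, a \in S -> exists2 w, w \in s & a \in B w.
Proof.
move=> P0 hY jP.
suff [s [sj hs]] : exists s : seq W, (size s <= j)%N /\
    #|[set a in S | ~~ has (fun w => a \in B w) s]|%:R <= #|S|%:R * expR (- (j%:R / P)).
  exists s => // a aS; apply/hasP/negPn/negP => na.
  have : #|[set a in S | ~~ has (fun w => a \in B w) s]|%:R < 1 :> R.
    by rewrite (le_lt_trans hs)// expRN ltr_pdivrMr ?expR_gt0// mul1r.
  rewrite -[1%R]/(1%:R) ltr_nat ltnS leqn0 cards_eq0 => /eqP/setP/(_ a).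
  by rewrite !inE aS na.
elim: j {jP} => [|j [s [sj hs]]].
  exists [::]; split => //; rewrite mul0r oppr0 expR0 mulr1 ler_nat.
  by apply/subset_leq_card/fintype.subsetP => a; rewrite inE => /andP[].
set Y := [set a in S | ~~ has _ s] in hs.
have [Y0|Y0] := eqVneq Y finset.set0.
  exists s; split; first exact: leqW.
  by rewrite -/Y Y0 cards0 mulr_ge0// expR_ge0.
have [|w hw] := hY Y _ Y0.
  by apply/fintype.subsetP => a; rewrite inE => /andP[].
exists (w :: s); split => //.
have -> : [set a in S | ~~ has (fun w0 => a \in B w0) (w :: s)] = Y :\: B w.
  by apply/setP => a; rewrite !inE/= negb_or andbCA.
have -> : #|Y :\: B w|%:R = #|Y|%:R - #|Y :&: B w|%:R :> R.
  by rewrite -(cardsID (B w) Y) natrD addrAC subrr add0r.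
have e1 : 1 - P^-1 <= expR (- P^-1) by exact: expR_ge1Dx.
apply: (@le_trans _ _ (#|Y|%:R * (1 - P^-1))).
  rewrite mulrBr mulr1 lerD2l lerN2 ler_pdivrMr//.
  by rewrite mulrC ltW.
apply: (@le_trans _ _ (#|Y|%:R * expR (- P^-1))); first exact: ler_wpM2l.
rewrite -natr1 mulrDl mul1r opprD expRD mulrA ler_wpM2r ?expR_ge0//.
Qed.

End greedy.

Section spread.
Variables (R : realType) (X : Type) (T : X -> X) (I : finType) (V : I -> set X).
Hypothesis hV : forall x, exists i, V i x.

(** Membership of a point in the cylinders of length [n] depends only on its
    itinerary, recording for each time all the sets [V i] that are visited. There
    are at most [2 ^ (n * #|I|)] itineraries, and [greedy_cover] is applied to
    them: its failure with [N_n - 1] words yields the set. The real field [R]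
    serves in the proof only, to measure the decay of the uncovered part. *)
Lemma spread_set (n : nat) (x0 : X) : (0 < n)%N ->
  exists Y : seq X, (0 < size Y)%N /\ forall w, size w = n ->
    (word_num T hV n * count (fun y => `[< cyl T V w y >]) Y <= 2 * n * #|I| * size Y)%N.
Proof.
move=> n0; set N := word_num T hV n; set q := #|I|.
have [i0 _] := hV x0.
have q0 : (0 < q)%N by apply/card_gt0P; exists i0.
have N0 : (0 < N)%N by exact: word_num_gt0.
(* When a single word suffices, any point forms a spread set. *)
have [N1|N2] := leqP N 1.
  exists [:: x0]; split => // w _; rewrite (@leq_trans (1 * 1))//.
    by rewrite leq_mul//= addn0 leq_b1.
  by rewrite muln1 !muln_gt0 n0 q0.
pose iti x : {ffun 'I_n -> {set I}} := 
    [ffun k => finset (fun i => `[< V i (iter (val k) T x) >])].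
pose S : {set {ffun 'I_n -> {set I}}} := finset (fun a => `[< exists x, iti x = a >]).
pose B (t : n.-tuple I) : {set {ffun 'I_n -> {set I}}} :=
  finset (fun a : {ffun 'I_n -> {set I}} => [forall k, tnth t k \in a k]).
have itiB x t : (iti x \in B t) = `[< cyl T V t x >].
  rewrite inE; apply/forallP/asboolP => h.
    apply/(cyl_nth T V i0) => k; rewrite size_tuple => kn.
    have := h (Ordinal kn); rewrite ffunE inE (tnth_nth i0).
    by move/asboolP.
  move=> k; rewrite ffunE inE (tnth_nth i0); apply/asboolP.
  by apply: (cyl_nth T V i0 _ _).1 => //; rewrite size_tuple.
(* With this [P], [N.-1] greedy steps multiply the number of uncovered
   itineraries by at most [exp (- n * q)], and [exp 1 > 2]; the factor 2 in [P]
   makes up for [N.-1] in place of [N]. *)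
pose P : R := (N%:R / (2 * n * q)%:R)%R.
have d0 : (0 < (2 * n * q)%:R :> R)%R by rewrite ltr0n !muln_gt0 n0 q0.
have P0 : (0 < P)%R by rewrite divr_gt0// ltr0n.
have [[Y [YS Y0 hY]]|no] := pselect (exists Y : {set {ffun 'I_n -> {set I}}},
    [/\ Y \subset S, Y != finset.set0 &
        forall t, (P * #|Y :&: B t|%:R <= #|Y|%:R)%R]).
  have /choice[g hg] : forall a, exists x, a \in S -> iti x = a.
    move=> a; have [aS|] := boolP (a \in S); last by exists x0.
    by move: (aS); rewrite inE => /asboolP[x xa]; exists x.
  exists [seq g a | a <- enum Y]; rewrite size_map -cardE.
  split; first by rewrite lt0n cards_eq0.
  move=> w wn; have wn' : size w == n by apply/eqP.
  pose t : n.-tuple I := Tuple wn'.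
  have -> : count (fun y => `[< cyl T V w y >]) [seq g a | a <- enum Y] =
      #|Y :&: B t|.
    rewrite count_map -sum1_count big_enum_cond -sum1_card.
    apply: eq_bigl => a; rewrite finset.in_setI.
    case aY : (a \in Y) => //=.
    have {2}<- : iti (g a) = a by apply: hg; apply: (fintype.subsetP YS).
    by rewrite itiB.
  move: (hY t); rewrite /P mulrAC ler_pdivrMr// -!natrM ler_nat.
  by rewrite [leqRHS]mulnC.
have jP : (#|S|%:R < expR ((N.-1)%:R / P) :> R)%R.
  apply: (@le_lt_trans _ _ (2 ^+ (n * q))%R).
    rewrite -natrX ler_nat; apply: leq_trans (max_card _) _.
    rewrite card_ffun card_ord -finset.cardsT -finset.powersetT.
    by rewrite finset.card_powerset finset.cardsT mulnC expnM.
  apply: (@lt_le_trans _ _ (expR (n * q)%:R)%R).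
    rewrite -[X in expR X]mulr1 expRM_natl.
    have e2 : (2 < expR 1 :> R)%R by have := @expR_gt1Dx R 1 (oner_neq0 _).
    by rewrite ltrXn2r// ?muln_eq0 ?negb_or -?lt0n ?n0//; lra.
  rewrite ler_expR /P invf_div mulrA ler_pdivlMr ?ltr0n// -!natrM ler_nat.
  have N2' : (N <= 2 * N.-1)%N by lia.
  by rewrite [leqRHS](_ : _ = (n * q * (2 * N.-1))%N) ?leq_mul2l ?N2' ?orbT//; ring.
have [|s sN scov] := @greedy_cover R _ _ B S P N.-1 P0 _ jP.
  move=> Y YS Y0; apply: contrapT => nw; apply: no; exists Y; split => // t.
  by rewrite leNgt; apply/negP => lt; apply: nw; exists t.
suff : (N <= size s)%N by move=> /leq_trans/(_ sN); rewrite leqNgt ltn_predL N0.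
rewrite -(size_map (@tval n I)); apply: word_num_le; split.
  by move=> w /mapP[t _ ->]; rewrite size_tuple.
move=> x; have [|t ts tx] := scov (iti x).
  by rewrite inE; apply/asboolP; exists x.
exists (tval t); first exact: map_f.
by apply/asboolP; rewrite -itiB.
Qed.
End spread.

(** * Coding orbits by blocks *)

Section coding.
Variables (X : Type) (T : X -> X) (I : finType) (V : I -> set X).
Variables (m : nat) (G M : seq (seq I)).
Hypothesis m0 : (0 < m)%N.
Hypothesis hG : forall w, w \in G -> size w = m.
Hypothesis hM : word_cover T V m M.

Definition word_union : set X := [set x | exists2 w, w \in G & cyl T V w x].

(** The concatenations of [l] words taken from [G], except for at most [b] of
    them taken from [M]. *)
Fixpoint blocks (l b : nat) : seq (seq I) :=
  if l is l'.+1 then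
    [seq g ++ v | g <- G, v <- blocks l' b] ++
    (if b is b'.+1 then [seq g ++ v | g <- M, v <- blocks l' b'] else [::])
  else [:: [::]].

Lemma size_blocks l b : (0 < size G)%N -> (0 < size M)%N ->
  (size (blocks l b) <= 2 ^ l * size G ^ l * size M ^ b)%N.
Proof.
move=> G0 M0; elim: l b => [|l ih] b /=.
  by rewrite !expn0 !mul1n expn_gt0 M0.
rewrite size_cat size_allpairs !expnS.
have -> : (2 * 2 ^ l * (size G * size G ^ l) * size M ^ b =
  size G * (2 ^ l * size G ^ l * size M ^ b) +
  size G * (2 ^ l * size G ^ l * size M ^ b))%N by ring.
apply: leq_add; first by rewrite leq_mul2l ih orbT.
case: b => [//|b]; rewrite size_allpairs.
apply: (@leq_trans (size M * (2 ^ l * size G ^ l * size M ^ b))).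
  by rewrite leq_mul2l ih orbT.
rewrite expnS [leqLHS](_ : _ = 1 * (2 ^ l * size G ^ l * (size M * size M ^ b)))%N.
  by rewrite leq_mul2r G0 orbT.
by ring.
Qed.

(** From a time in the union of the cylinders of [G], an orbit is described for
    [m] steps by a word of [G]; from any other time, by a word of [M]. *)
Lemma blocks_cover l b x :
  (\sum_(i < l) ~~ `[< word_union (iter (i * m) T x) >] <= b)%N ->
  exists2 v, v \in blocks l b & size v = (l * m)%N /\ cyl T V v x.
Proof.
elim: l b x => [|l ih] b x; first by exists [::].
rewrite big_ord_recl/=.
have -> : (\sum_(i < l) ~~ `[< word_union (iter (lift ord0 i * m) T x) >] =
    \sum_(i < l) ~~ `[< word_union (iter (i * m) T (iter m T x)) >])%N.
  by apply: eq_bigr => i _; rewrite -iterD /= mulSn addnC.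
case: asboolP => [[g gG gx]|_] /=.
  rewrite add0n => /ih[v vb [sv cv]]; exists (g ++ v).
    by rewrite mem_cat; apply/orP; left; apply/allpairsP; exists (g, v).
  rewrite size_cat (hG gG) sv; split=> //.
  by apply/cyl_cat; rewrite (hG gG).
case: b => // b; rewrite add1n ltnS => /ih[v vb [sv cv]].
have [g gM gx] := hM.2 x; have sg := hM.1 g gM.
exists (g ++ v).
  by rewrite mem_cat; apply/orP; right; apply/allpairsP; exists (g, v).
by rewrite size_cat sg sv; split=> //; apply/cyl_cat; rewrite sg.
Qed.

(** Pigeonhole: the times [j + i * m] with [j < m] and [i < n %/ m] are distinct
    and smaller than [n], so that the visits outside the union are shared by
    the [m] residues [j]. *)
Lemma good_phase n (B : nat) x : (visits T n (~` word_union) x <= B)%N ->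
  exists2 j, (j < m)%N &
    (m * \sum_(i < n %/ m) ~~ `[< word_union (iter (i * m) T (iter j T x)) >] <= B)%N.
Proof.
move=> hB; pose bad k : nat := `[< (~` word_union) (iter k T x) >].
pose s (j : nat) := (\sum_(i < n %/ m) bad (i * m + j))%N.
have sE j : s j = (\sum_(i < n %/ m) ~~ `[< word_union (iter (i * m) T (iter j T x)) >])%N.
  by apply: eq_bigr => i _; rewrite /bad asbool_neg iterD.
suff [j jm hj] : exists2 j, (j < m)%N & (m * s j <= B)%N by exists j => //; rewrite -sE.
have sumB : (\sum_(j < m) s j <= B)%N.
  apply: leq_trans hB; rewrite exchange_big/=.
  rewrite /visits -(big_mkord xpredT bad).
  rewrite -(big_mkord xpredT (fun i => \sum_(j < m) bad (i * m + j))%N).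
  rewrite [leqRHS](@big_cat_nat _ _ _ (n %/ m * m)) ?leq_trunc_div//=.
  apply: leq_trans (leq_addr _ _).
  rewrite big_nat_mul; apply: leq_sum => i _.
  rewrite -{2}[(i * m)%N]add0n big_addn mulSn addnK big_mkord.
  by apply: leq_sum => j _; rewrite addnC.
apply: contrapT => no.
have : (m * B.+1 <= m * \sum_(j < m) s j)%N.
  rewrite big_distrr/= -[X in (X * _)%N]card_ord -sum_nat_const.
  apply: leq_sum => j _; rewrite ltnNge; apply/negP => h.
  by apply: no; exists j.
by rewrite leq_mul2l (gtn_eqF m0)/= leqNgt ltnS sumB.
Qed.

(** An arbitrary word of length [j < m] up to the first block, the blocks, and an
    arbitrary word of length [m] that is long enough to reach time [n]. *)
Definition codes (n b : nat) : seq (seq I) :=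
  [seq w <- flatten [seq [seq take n (u ++ v) | u <- words I j,
      v <- [seq v ++ z | v <- blocks (n %/ m) b, z <- words I m]] | j <- iota 0 m]
   | size w == n].

Lemma size_codes n b : (0 < #|I|)%N -> (0 < size G)%N -> (0 < size M)%N ->
  (size (codes n b) <=
    m * (#|I| ^ m * (2 ^ (n %/ m) * size G ^ (n %/ m) * size M ^ b * #|I| ^ m)))%N.
Proof.
move=> I0 G0 M0; rewrite size_filter; apply: leq_trans (count_size _ _) _.
rewrite size_flatten /shape -map_comp sumnE big_map.
apply: (@leq_trans (\sum_(j <- iota 0 m)
  (#|I| ^ m * (2 ^ (n %/ m) * size G ^ (n %/ m) * size M ^ b * #|I| ^ m)))).
  rewrite big_seq [leqRHS]big_seq; apply: leq_sum => j; rewrite mem_iota add0n => /andP[_ jm].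
  rewrite /= !size_allpairs !size_words; apply: leq_mul.
    by rewrite leq_pexp2l// ltnW.
  by rewrite leq_mul2r size_blocks ?orbT.
by rewrite big_const_seq count_predT size_iota iter_addn_0 mulnC.
Qed.

Hypothesis hV : forall x, exists i, V i x.

Lemma codes_cover n (B : nat) x : (visits T n (~` word_union) x <= B)%N ->
  exists2 w, w \in codes n (B %/ m) & size w = n /\ cyl T V w x.
Proof.
move=> /good_phase[j jm hj].
have /blocks_cover[v vb [sv cv]] : (\sum_(i < n %/ m)
    ~~ `[< word_union (iter (i * m) T (iter j T x)) >] <= B %/ m)%N.
  by rewrite leq_divRL// mulnC.
have [u uw cu] := (words_cover T hV j).2 x.
have su := (words_cover T hV j).1 u uw.
have [z zw cz] := (words_cover T hV m).2 (iter (n %/ m * m) T (iter j T x)).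
have sz := (words_cover T hV m).1 z zw.
have sw : size (take n (u ++ (v ++ z))) = n.
  rewrite size_takel// !size_cat su sv sz.
  apply: leq_trans (leq_addl _ _); rewrite {1}(divn_eq n m) leq_add2l.
  by rewrite ltnW// ltn_pmod.
exists (take n (u ++ (v ++ z))).
  rewrite mem_filter sw eqxx /=; apply/flatten_mapP; exists j.
    by rewrite mem_iota add0n jm.
  apply/allpairsP; exists (u, v ++ z) => /=; split => //.
  by apply/allpairsP; exists (v, z).
split=> //; apply: cyl_take; apply/cyl_cat; split=> //.
by rewrite su; apply/cyl_cat; rewrite sv.
Qed.

Lemma count_codes (Y : seq X) (a : pred X) (W : seq (seq I)) (N C : nat) :
  (forall y, a y -> exists2 w, w \in W & cyl T V w y) ->
  (forall w, w \in W -> (N * count (fun y => `[< cyl T V w y >]) Y <= C)%N) ->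
  (N * count a Y <= size W * C)%N.
Proof.
move=> cW hW; apply: (@leq_trans (\sum_(w <- W) C)); last first.
  by rewrite big_const_seq count_predT iter_addn_0 mulnC.
apply: (@leq_trans (\sum_(w <- W) N * count (fun y => `[< cyl T V w y >]) Y)).
  rewrite -big_distrr leq_mul2l/=; apply/orP; right.
  under eq_bigr do rewrite -sum1_count big_mkcond.
  rewrite exchange_big/= -sum1_count big_mkcond/=; apply: leq_sum => y _.
  case: ifPn => // /cW[w wW wy]; rewrite (big_rem w)//= asboolT//.
by rewrite big_seq [leqRHS]big_seq; apply: leq_sum => w; exact: hW.
Qed.

(** Half of [Y] is covered by the cylinders of [codes], each of which contains
    only a proportion [C / N_n] of [Y]. *)
Lemma word_num_coding (Y : seq X) (n B C : nat) :
  (0 < #|I|)%N -> (0 < size G)%N -> (0 < size M)%N -> (0 < size Y)%N ->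
  (forall w, size w = n ->
    (word_num T hV n * count (fun y => `[< cyl T V w y >]) Y <= C * size Y)%N) ->
  (size Y <= 2 * count (fun y => visits T n (~` word_union) y <= B)%N Y)%N ->
  (word_num T hV n <= 2 * C * (m * (#|I| ^ m *
    (2 ^ (n %/ m) * size G ^ (n %/ m) * size M ^ (B %/ m) * #|I| ^ m))))%N.
Proof.
move=> I0 G0 M0 Y0 hY half; set N := word_num T hV n.
rewrite -(leq_pmul2r Y0).
apply: (@leq_trans (2 * (N * count (fun y => visits T n (~` word_union) y <= B)%N Y))).
  by rewrite mulnCA leq_mul2l half orbT.
apply: (@leq_trans (2 * (size (codes n (B %/ m)) * (C * size Y)))).
  rewrite leq_mul2l/=; apply: count_codes.
    by move=> y /codes_cover[w wc [_ wy]]; exists w.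
  by move=> w; rewrite mem_filter => /andP[/eqP wn _]; exact: hY.
rewrite [leqLHS](_ : _ = 2 * C * size (codes n (B %/ m)) * size Y)%N; last by ring.
by rewrite leq_mul2r leq_mul2l size_codes ?orbT.
Qed.

End coding.

(** * Limits superior, Bowen balls and separated sets *)

Section limsup.
Variables (R : realType) (T : choiceType) (X : filteredType T) (F : set_system X).
Hypothesis FF : Filter F.
Implicit Types (f : X -> \bar R) (c : \bar R).

Lemma limf_esup_lt f c : limf_esup f F < c -> \forall x \near F, f x < c.
Proof.
move=> /ereal_inf_lt[_ [A FA <-] Ac]; apply: filterS FA => x Ax.
by apply: le_lt_trans Ac; apply: ereal_sup_ubound; exists x.
Qed.

Lemma limf_esup_gt f c (A : set X) : c < limf_esup f F -> F A ->
  exists2 x, A x & c < f x.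
Proof.
move=> cf FA; have /ereal_sup_gt[_ [x Ax <-] cx] : c < ereal_sup (f @` A).
  by apply: lt_le_trans cf _; apply: ereal_inf_lbound; exists A.
by exists x.
Qed.

Lemma limf_esup_le f c : (\forall x \near F, f x <= c) -> limf_esup f F <= c.
Proof.
move=> fc; apply: le_trans (ereal_inf_lbound _) _.
  by exists [set x | f x <= c]; first exact: fc.
by apply: ge_ereal_sup => _ [x xc <-].
Qed.

Lemma limf_esup_ge f c : ProperFilter F ->
  (\forall x \near F, c <= f x) -> c <= limf_esup f F.
Proof.
move=> PF cf; apply: le_ereal_inf_tmp => _ [A FA <-].
have [x [Ax cx]] := filter_ex (filterI FA cf).
by apply: le_trans cx _; apply: ereal_sup_ubound; exists x.
Qed.

Lemma le_limf_esup f g : (\forall x \near F, f x <= g x) ->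
  limf_esup f F <= limf_esup g F.
Proof.
move=> fg; apply: le_ereal_inf_tmp => _ [A FA <-].
apply: limf_esup_le; near=> x; apply: (@le_trans _ _ (g x)).
  by near: x.
apply: ereal_sup_ubound; exists x => //; near: x; exact: FA.
Unshelve. all: by end_near. Qed.

End limsup.

(** Bounding the finite lists of elements of [E] also excludes that [E] is
    infinite. *)
Lemma counting_le (R : realType) (X : choiceType) (E : set X) (k : nat) :
  (forall s : seq X, uniq s -> (forall x, x \in s -> E x) -> (size s <= k)%N) ->
  counting E <= (k%:R : R)%:E.
Proof.
move=> h; rewrite /counting; case: asboolP => [fE|iE].
  rewrite lee_fin ler_nat; apply: h; first exact: fset_uniq.
  by move=> x; rewrite in_fset_set// inE.
have [B BE kB] := infinite_set_fset k.+1 iE.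
suff : (#|` B| <= k)%N by rewrite leqNgt kB.
by apply: h; [exact: fset_uniq|move=> x xB; apply: BE].
Qed.

Lemma counting_nonneg (R : realType) (X : choiceType) (E : set X) :
  0 <= counting E :> \bar R.
Proof. by rewrite /counting; case: asboolP => _; rewrite ?lee_fin ?leey. Qed.

Section bowen.
Variables (R : realType) (X : pmetricType R) (T : X -> X).

Lemma mdist_le_bowen n k x y : (k < n)%N ->
  (mdist (iter k T x) (iter k T y) <= bowen_dist T n x y)%R.
Proof.
move=> kn; rewrite /bowen_dist.
exact: (@le_bigmax _ _ _ 0%R (fun k : 'I_n => mdist (iter k T x) (iter k T y)) (Ordinal kn)).
Qed.

Lemma bowen_dist_le n e x y : (0 <= e)%R ->
  (forall k, (k < n)%N -> (mdist (iter k T x) (iter k T y) <= e)%R) ->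
  (bowen_dist T n x y <= e)%R.
Proof. by move=> e0 h; apply: bigmax_le => // i _; exact: h. Qed.

Lemma bowen_distC n x y : bowen_dist T n x y = bowen_dist T n y x.
Proof. by apply: eq_bigr => i _; rewrite metric_sym. Qed.

Lemma bowen_distxx n x : bowen_dist T n x x = 0%R.
Proof.
apply/eqP; rewrite eq_le; apply/andP; split; last exact: bigmax_ge_id.
by apply: bowen_dist_le => // k _; rewrite mdistxx.
Qed.

Lemma open_mdist_lt (c : X) (r : R) : open [set x | mdist c x < r]%R.
Proof.
rewrite openE => x /= xr; apply/nbhs_ballP; exists (r - mdist c x)%R => /=.
  by rewrite subr_gt0.
move=> y; rewrite ballEmdist/= => xy.
by apply: le_lt_trans (metric_triangle _ x _) _; rewrite -ltrBrDl.
Qed.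

End bowen.

Section ball_cover.
Variables (R : realType) (X : pmetricType R) (T : X -> X).
Hypothesis cX : compact [set: X].

Lemma finite_net (r : R) : (0 < r)%R ->
  exists (I : finType) (c : I -> X), forall x, exists i, (mdist (c i) x < r)%R.
Proof.
move=> r0; move: (cX); rewrite compact_cover =>
  /(_ _ [set: X] (fun c => [set x | mdist c x < r]%R)).
case.
- by move=> c _; exact: open_mdist_lt.
- by move=> x _; exists x => //=; rewrite mdistxx.
move=> D _ hD; exists D, val => x.
by have [c cD cx] := hD x Logic.I; exists [` cD]%fset.
Qed.

Variables (I : finType) (c : I -> X) (r : R).
Hypothesis r0 : (0 < r)%R.
Hypothesis hc : forall x, exists i, (mdist (c i) x < r)%R.

(** Twice the radius of the net, so that every ball of radius [r] is contained
    in one of these balls. *)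
Definition big_ball (i : I) : set X := [set x | mdist (c i) x < r + r]%R.

Lemma big_ball_cover x : exists i, big_ball i x.
Proof. by have [i ix] := hc x; exists i; apply: lt_trans ix _; rewrite ltrDl. Qed.

Lemma dyn_ball_word n x :
  exists2 w : seq I, size w = n & dyn_ball T n r x `<=` cyl T big_ball w.
Proof.
have [f hf] := choice hc.
exists [seq f (iter k T x) | k <- iota 0 n]; first by rewrite size_map size_iota.
move=> y xy; apply/(cyl_nth T big_ball (f x)) => k.
rewrite size_map size_iota => kn; rewrite (nth_map 0%N) ?size_iota// nth_iota// add0n.
rewrite /big_ball/=; apply: le_lt_trans (metric_triangle _ (iter k T x) _) _.
by rewrite ltrD// (le_lt_trans _ xy)// mdist_le_bowen.
Qed.

(** Two points in one cylinder of length [n] are at Bowen distance less than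
    [4 * r]. *)
Lemma separated_size n (s : seq X) : uniq s ->
  Defs.separated T n (4 * r)%R [set` s] -> (size s <= word_num T big_ball_cover n)%N.
Proof.
move=> us sep; have [W cW <-] := word_num_cover T big_ball_cover n.
have /choice[f hf] : forall x, exists w, w \in W /\ cyl T big_ball w x.
  by move=> x; have [w ? ?] := cW.2 x; exists w.
rewrite -(size_map f); apply: uniq_leq_size; last first.
  by move=> _ /mapP[x _ ->]; case: (hf x).
rewrite map_inj_in_uniq// => x y xs ys fxy; apply: contrapT => xy.
have := sep x y xs ys xy; rewrite ltNge => /negP; apply.
apply: bowen_dist_le; first by rewrite mulr_ge0// ltW.
move=> k kn; have [i0 _] := hc x.
have [fW fx] := hf x; have [_ fy] := hf y.
have sz := cW.1 _ fW.
have := (cyl_nth T big_ball i0 _ _).1 fx k; rewrite sz => /(_ kn).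
have := (cyl_nth T big_ball i0 _ _).1 fy k; rewrite -fxy sz => /(_ kn).
rewrite /big_ball/= => h1 h2.
apply: le_trans (metric_triangle _ (c (nth i0 (f x) k)) _) _.
rewrite (metric_sym (iter k T x)) (_ : 4 * r = (r + r) + (r + r))%R; last by ring.
by rewrite lerD// ltW.
Qed.

Lemma sep_number_le n :
  sep_number T n (4 * r)%R <= ((word_num T big_ball_cover n)%:R)%:E.
Proof.
apply: ge_ereal_sup => _ [E sE <-]; apply: counting_le => s us sE'.
by apply: separated_size => // x y /sE' xE /sE' yE; exact: sE.
Qed.

End ball_cover.

Section upper.
Variables (R : realType) (X : pmetricType R) (T : X -> X).
Hypothesis cX : compact [set: X].

(** Separated sets are bounded in size by [separated_size], so that one of
    maximal size exists, and no point can be added to it. *)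
Lemma maximal_separated n (e : R) : (0 < e)%R ->
  exists2 E : set X, Defs.separated T n e E &
    forall x, exists2 y, E y & (bowen_dist T n y x <= e)%R.
Proof.
move=> e0; have r0 : (0 < e / 4)%R by rewrite divr_gt0.
have [I [c hc]] := finite_net cX r0.
pose P k := `[< exists s : seq X, [/\ uniq s, Defs.separated T n e [set` s] & size s = k] >].
have P0 : exists k, P k.
  by exists 0%N; apply/asboolP; exists [::]; split => // x y; rewrite /= in_nil.
have Pb k : P k -> (k <= word_num T (big_ball_cover r0 hc) n)%N.
  move=> /asboolP[s [us sep <-]]; apply: separated_size => //.
  by rewrite mulrC divfK.
have [k /asboolP[s [us sep sk]] kmax] := ex_maxnP P0 Pb.
exists [set` s] => // x; apply: contrapT => no.
have far y : y \in s -> (e < bowen_dist T n y x)%R.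
  by move=> ys; rewrite ltNge; apply/negP => yx; apply: no; exists y.
have : P k.+1.
  apply/asboolP; exists (x :: s); split => /=.
  - rewrite us andbT; apply/negP => /far.
    by rewrite bowen_distxx ltNge (ltW e0).
  - move=> y z /=; rewrite !inE => /orP[/eqP->|ys] /orP[/eqP->|zs] yz //.
    + by rewrite bowen_distC; exact: far.
    + exact: far.
    + exact: sep.
  - by rewrite sk.
by move=> /kmax; rewrite ltnn.
Qed.

Lemma cover_number_le_sep (mu : probability (borel X) R) n (e delta : R) :
  (0 < e)%R -> (0 < delta)%R ->
  cover_number T mu n e delta <= sep_number T n (e / 2)%R.
Proof.
move=> e0 d0; have e20 : (0 < e / 2)%R by rewrite divr_gt0.
have [E sE hE] := maximal_separated n e20.
apply: (@le_trans _ _ (counting E)); last by apply: ereal_sup_ubound; exists E.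
apply: ereal_inf_lbound; exists E => //; exists setT; split => //.
- by rewrite probability_setT lte_fin ltrBlDr ltrDl.
- move=> x _; have [y Ey yx] := hE x; exists y => //.
  apply: le_lt_trans yx _.
  by rewrite ltr_pdivrMr// ltr_pMr// ltr1n.
Qed.

Lemma katok_entropy_le (mu : probability (borel X) R) (e delta : R) :
  (0 < e)%R -> (0 < delta)%R ->
  katok_entropy T mu e delta <= sep_growth T (e / 2)%R.
Proof.
move=> e0 d0; apply: le_limf_esup; apply: nearW => n.
apply: lee_wpmul2l; first by rewrite lee_fin.
have cov0 : 0 <= cover_number T mu n e delta.
  by apply: le_ereal_inf_tmp => _ [E _ <-]; exact: counting_nonneg.
have le := cover_number_le_sep mu n e0 d0.
by rewrite lee_lne// in_itv/= leey andbT// (le_trans cov0).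
Qed.

End upper.

(** * Counting estimates *)

(** Markov inequality: the average proportion of time spent outside [U] is less
    than [delta], so that it exceeds [2 * delta] for less than half of [Y]. *)
Lemma empirical_half (R : realType) (X : Type) (T : X -> X) (U : set X)
    (Y : seq X) (n : nat) (delta : R) :
  (0 < n)%N -> (0 < size Y)%N -> (0 < delta)%R ->
  (1 - delta < empirical R T Y n U)%R ->
  (size Y <= 2 * count (fun y => visits T n (~` U) y <= Num.truncn (2 * delta * n%:R))%N Y)%N.
Proof.
move=> n0 Y0 d0; set B := Num.truncn _; set a := (fun y => _).
have D0 : (0 < (n * size Y)%:R :> R)%R by rewrite ltr0n muln_gt0 n0.
rewrite /empirical ltr_pdivlMr// => hU.
have sumE : (\sum_(y <- Y) visits T n U y + \sum_(y <- Y) visits T n (~` U) y = n * size Y)%N.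
  rewrite -big_split/=; transitivity (\sum_(y <- Y) n)%N; last first.
    by rewrite big_const_seq count_predT iter_addn_0.
  by apply: eq_bigr => y _; rewrite -visitsU ?setICr// setUCr visitsT.
have sumlt : ((\sum_(y <- Y) visits T n (~` U) y)%:R < delta * n%:R * (size Y)%:R)%R.
  have := congr1 (fun k => k%:R : R)%R sumE; rewrite natrD => e.
  by move: hU; rewrite -mulrA -natrM -e; lra.
have bad : ((count (predC a) Y)%:R * (2 * delta * n%:R) <=
    (\sum_(y <- Y) visits T n (~` U) y)%:R :> R)%R.
  rewrite -sum1_count natr_sum mulr_suml natr_sum big_mkcond/=.
  apply: ler_sum => y _; rewrite mul1r; case: ifPn => [|_]; last by rewrite ler0n.
  rewrite /a -ltnNge => lt; apply/ltW/(lt_le_trans (truncnS_gt _)).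
  by rewrite ler_nat.
have := le_lt_trans bad sumlt.
rewrite (_ : _ * _ = delta * n%:R * (2 * (count (predC a) Y)%:R))%R; last by ring.
rewrite ltr_pM2l ?mulr_gt0 ?ltr0n//.
rewrite -(count_predC a Y) -natrM ltr_nat.
lia.
Qed.

Lemma ln_le_sublinear (R : realType) (c eta : R) : (0 < c)%R -> (0 < eta)%R ->
  exists n0, forall n, (n0 <= n)%N -> (ln (c * n%:R) <= eta * n%:R)%R.
Proof.
move=> c0 e0; exists (Num.truncn (4 * c / eta ^+ 2)).+1 => n n0n.
have np : (0 < n%:R :> R)%R by rewrite ltr0n (leq_trans _ n0n).
rewrite -[leRHS]expRK ler_ln ?posrE ?mulr_gt0 ?expR_gt0//.
have h : (4 * c / eta ^+ 2 <= n%:R)%R.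
  by rewrite ltW// (lt_le_trans (truncnS_gt _))// ler_nat.
have -> : (eta * n%:R = eta * n%:R / 2 + eta * n%:R / 2)%R by rewrite -splitr.
rewrite expRD -expr2.
apply: (@le_trans _ _ ((eta * n%:R / 2) ^+ 2)%R); last first.
  rewrite ler_sqr ?nnegrE ?expR_ge0 ?divr_ge0 ?mulr_ge0 ?(ltW e0)//.
  apply: (@le_trans _ _ (1 + eta * n%:R / 2)%R); first by rewrite lerDr.
  exact: expR_ge1Dx.
move: h; rewrite ler_pdivrMr ?exprn_gt0// => h.
have -> : ((eta * n%:R / 2) ^+ 2 = (n%:R * eta ^+ 2) * n%:R / 4)%R by field.
rewrite ler_pdivlMr// mulrAC ler_pM2r// mulrC//.
Qed.

(** The logarithm of the bound of [word_num_coding] with the constant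
    [C = 2 n q] of [spread_set]. *)
Lemma ln_word_bound (R : realType) (N M K q m n B : nat) (delta : R) :
  (0 < N)%N -> (0 < M)%N -> (0 < K)%N -> (0 < q)%N -> (0 < m)%N -> (0 < n)%N ->
  (B%:R <= 2 * delta * n%:R)%R ->
  (N <= 2 * (2 * n * q) * (m * (q ^ m *
    (2 ^ (n %/ m) * K ^ (n %/ m) * M ^ (B %/ m) * q ^ m))))%N ->
  (ln N%:R <= ln ((4 * q * m * q ^ m * q ^ m)%:R * n%:R) +
     (ln 2 / m%:R + ln K%:R / m%:R + 2 * delta * (ln M%:R / m%:R)) * n%:R :> R)%R.
Proof.
move=> N0 M0 K0 q0 m0 n0 hB hN.
have mp : (0 < m%:R :> R)%R by rewrite ltr0n.
pose l := (n %/ m)%N; pose b := (B %/ m)%N.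
have -> : ((4 * q * m * q ^ m * q ^ m)%:R * n%:R = (4 * q * m * q ^ m * q ^ m * n)%:R :> R)%R.
  by rewrite [RHS]natrM.
set c := (4 * q * m * q ^ m * q ^ m * n)%N.
have c0 : (0 < c)%N by rewrite /c !muln_gt0 !expn_gt0 q0 m0 n0.
apply: (@le_trans _ _ (ln (c * (2 ^ l * K ^ l * M ^ b))%:R)).
  rewrite ler_ln ?posrE ?ltr0n//; last by rewrite muln_gt0 c0 !muln_gt0 !expn_gt0 K0 M0.
  rewrite ler_nat (leq_trans hN)//; apply: eq_leq; rewrite /c -/l -/b; ring.
have lnl (k : nat) : (0 < k)%N -> (ln (k ^ l)%:R <= ln k%:R / m%:R * n%:R :> R)%R.
  move=> k0; rewrite natrX lnXn ?ltr0n// -[leLHS]mulr_natr mulrAC -mulrA ler_wpM2l//.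
    by rewrite ln_ge0// ler1n.
  by rewrite ler_pdivlMr// -natrM ler_nat leq_trunc_div.
have lnb : (ln (M ^ b)%:R <= 2 * delta * (ln M%:R / m%:R) * n%:R :> R)%R.
  rewrite natrX lnXn ?ltr0n// -[leLHS]mulr_natr.
  rewrite (_ : 2 * delta * _ * _ = ln M%:R * (2 * delta * n%:R / m%:R))%R; last by ring.
  rewrite ler_wpM2l ?ln_ge0 ?ler1n// ler_pdivlMr// -natrM (le_trans _ hB)//.
  by rewrite ler_nat leq_trunc_div.
rewrite (natrM _ c) (natrM _ (2 ^ l * K ^ l)) (natrM _ (2 ^ l)).
rewrite !lnM ?posrE ?mulr_gt0 ?ltr0n ?expn_gt0 ?K0 ?M0//.
rewrite lerD2l mulrDl; apply: lerD; last exact: lnb.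
by rewrite mulrDl; apply: lerD; exact: lnl.
Qed.

Section open_words.
Variables (X : topologicalType) (T : X -> X) (I : finType) (V : I -> set X).
Hypothesis cT : continuous T.
Hypothesis oV : forall i, open (V i).

Lemma open_cyl w : open (cyl T V w).
Proof.
elim: w => [|i w ih] /=; first exact: openT.
by apply: openI => //; exact: (proj1 (continuousP _) cT).
Qed.

Lemma open_word_union G : open (word_union T V G).
Proof.
rewrite (_ : word_union T V G = \bigcup_(w in [set` G]) cyl T V w).
  by apply: bigcup_open => w _; exact: open_cyl.
by apply/seteqP; split => x [w wG wx]; exists w.
Qed.

End open_words.

(** * The lower bound at a fixed scale *)

Section lower.
Variables (R : realType) (X : pmetricType R) (T : X -> X).
Hypothesis cX : compact [set: X].
Hypothesis cT : continuous T.
Variables (I : finType) (c : I -> X) (r : R).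
Hypothesis r0 : (0 < r)%R.
Hypothesis hc : forall x, exists i, (mdist (c i) x < r)%R.

Let N n := word_num T (big_ball_cover r0 hc) n.

Let q_gt0 : (0 < #|I|)%N.
Proof. by have [i _] := hc point; apply/card_gt0P; exists i. Qed.

Let N_gt0 n : (0 < N n)%N.
Proof. exact: (word_num_gt0 _ _ _ point). Qed.

Definition word_rate n : R := (ln (N n)%:R / n%:R)%R.

Definition word_growth : \bar R := limn_esup (fun n => (word_rate n)%:E).

Lemma word_rate_ge0 n : (0 <= word_rate n)%R.
Proof. by rewrite divr_ge0// ln_ge0// ler1n. Qed.

Lemma word_rate_le n : (word_rate n <= ln #|I|%:R)%R.
Proof.
have lnq : (0 <= ln #|I|%:R :> R)%R by rewrite ln_ge0// ler1n.
case: n => [|n]; first by rewrite /word_rate invr0 mulr0.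
rewrite /word_rate ler_pdivrMr ?ltr0n// mulr_natr -lnXn ?ltr0n//.
rewrite ler_ln ?posrE ?exprn_gt0 ?ltr0n// -natrX ler_nat.
exact: word_num_le_exp.
Qed.

Lemma word_growth_fin_num : word_growth \is a fin_num.
Proof.
rewrite fin_real//; apply/andP; split.
  apply: (@lt_le_trans _ _ 0); first by rewrite ltNyr.
  by apply: limf_esup_ge; apply: nearW => n; rewrite lee_fin word_rate_ge0.
apply: (@le_lt_trans _ _ (ln #|I|%:R)%:E); last by rewrite ltry.
by apply: limf_esup_le; apply: nearW => n; rewrite lee_fin word_rate_le.
Qed.

Lemma sep_growth_le : sep_growth T (4 * r)%R <= word_growth.
Proof.
apply: le_limf_esup; apply: nearW => n.
rewrite /word_rate [X in _ <= X%:E]mulrC EFinM. apply: lee_wpmul2l; first by rewrite lee_fin.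
rewrite -lne_EFin ?ltr0n//.
have s0 : 0 <= sep_number T n (4 * r)%R.
  apply: le_trans (ereal_sup_ubound _); last first.
    by exists set0 => // x y [].
  exact: counting_nonneg.
rewrite lee_lne ?in_itv/= ?s0 ?leey ?lee_fin ?ler0n//.
exact: sep_number_le.
Qed.

(** The empirical measures are taken along times [n] at which the word rate is
    at least [t - eta], whereas the rate at [m] is at most [t + eta] for all large
    [m]. If [K] Bowen balls cover a set of measure more than [1 - delta], the coding
    bound reads [t - eta <= 2 eta + (ln K) / m + 2 delta (t + eta)]. *)
Lemma exists_katok_ge (delta eta : R) :
  (0 < delta)%R -> (delta < 1 / 2)%R -> (0 < eta)%R ->
  exists2 mu, invariant_prob T mu &
    ((1 - 2 * delta) * fine word_growth - 4 * eta)%:E <= katok_entropy T mu r delta.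
Proof.
move=> d0 d1 eta0; set t := fine word_growth.
have tE : word_growth = t%:E by rewrite fineK// word_growth_fin_num.
have t0 : (0 <= t)%R.
  apply: fine_ge0; apply: limf_esup_ge; apply: nearW => n.
  by rewrite lee_fin word_rate_ge0.
have upper : \forall m \near \oo, (word_rate m <= t + eta)%R.
  have := @limf_esup_lt R _ _ \oo _ (fun n => (word_rate n)%:E) (t + eta)%:E.
  rewrite -[limf_esup _ _]/word_growth tE lte_fin ltrDl => /(_ _ eta0).
  by apply: filterS => m; rewrite lte_fin; exact: ltW.
pose D := [set n | (t - eta <= word_rate n)%R].
have freq (n0 : nat) : exists2 n, (n0 <= n)%N & D n.
  have := @limf_esup_gt R _ _ \oo (fun n => (word_rate n)%:E) (t - eta)%:E
    [set n | (n0 <= n)%N].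
  rewrite -[limf_esup _ _]/word_growth tE lte_fin gtrBl => /(_ eta0).
  have : \oo [set n | (n0 <= n)%N] by exists n0.
  move=> h /(_ h)[n /= n0n]; rewrite lte_fin => /ltW Dn.
  by exists n.
(* The tails of the set of times at which the rate is almost [t]. *)
pose F := filter_from setT (fun n0 : nat => [set n | (n0 <= n)%N /\ D n]).
have pF : ProperFilter F.
  apply: filter_from_proper; last by move=> n0 _; have [n ? ?] := freq n0; exists n.
  apply: filter_from_filter; first by exists 0%N.
  move=> i j _ _; exists (maxn i j) => // n /= [].
  by rewrite geq_max => /andP[].
have ooF : \oo `<=` F by move=> A [n0 _ hA]; exists n0 => // n /= [n0n _]; exact: hA.
have /choice[Y hY] : forall n, exists Y : seq X, (0 < size Y)%N /\ ((0 < n)%N ->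
    forall w, size w = n ->
    (N n * count (fun y => `[< cyl T (big_ball c r) w y >]) Y <= 2 * n * #|I| * size Y)%N).
  move=> [|n]; first by exists [:: point].
  have [Y [Y0 h]] := spread_set R T (big_ball_cover r0 hc) point (ltn0Sn n).
  by exists Y.
have [|mu [inv hmu]] := empirical_limit cX cT pF ooF (Y := Y).
  by move=> n; case: (hY n).
exists mu => //.
apply: limf_esup_ge.
near=> m.
have m0 : (0 < m)%N by near: m; exact: nbhs_infty_gt.
have mp : (0 < m%:R :> R)%R by rewrite ltr0n.
have am : (word_rate m <= t + eta)%R by near: m.
have ln2m : (ln 2 / m%:R <= eta)%R.
  rewrite ler_pdivrMr// -ler_pdivrMl//.
  near: m; exact: nbhs_infty_ger.
set s := ((1 - 2 * delta) * t - 4 * eta)%R.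
suff cov : (expR (s * m%:R))%:E <= cover_number T mu m r delta.
  have : (s * m%:R)%:E <= lne (cover_number T mu m r delta).
    rewrite -[leLHS](_ : lne (expR (s * m%:R))%:E = _); last first.
      by rewrite lne_EFin ?expR_gt0// expRK.
    rewrite lee_lne// in_itv/= leey andbT ?lee_fin ?expR_ge0//.
    by apply: le_trans cov; rewrite lee_fin expR_ge0.
  move=> h; rewrite -[s](_ : m%:R^-1 * (s * m%:R) = s)%R; last by field; rewrite gt_eqF.
  by rewrite EFinM; apply: lee_wpmul2l; rewrite ?lee_fin ?invr_ge0.
apply: le_ereal_inf_tmp => _ [E [A [mA Adelta AE]] <-].
rewrite /counting; case: asboolP => [fE|_]; last by rewrite leey.
set K := #|` fset_set E|.
have /choice[wd hwd] : forall x, exists w : seq I,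
    size w = m /\ dyn_ball T m r x `<=` cyl T (big_ball c r) w.
  by move=> x; have [w ? ?] := dyn_ball_word T hc m x; exists w.
pose G := [seq wd x | x <- fset_set E].
have sG : size G = K by rewrite size_map.
have hG w : w \in G -> size w = m by move=> /mapP[x _ ->]; case: (hwd x).
pose U := word_union T (big_ball c r) G.
have AU : A `<=` U.
  move=> x /AE[y Ey yx]; exists (wd y); last by case: (hwd y) => _; exact.
  by apply: map_f; rewrite in_fset_set// inE.
have oU : open U.
  by apply: open_word_union => // i; exact: open_mdist_lt.
have mU : measurable (U : set (borel X)) by exact: sub_sigma_algebra.
have Udelta : (1 - delta)%:E < mu U.
  by apply: lt_le_trans Adelta _; apply: le_measure; rewrite ?inE.
have K0 : (0 < K)%N.
  rewrite -sG lt0n; apply/eqP => /size0nil G0.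
  have : mu A = 0.
    rewrite (_ : A = set0) ?measure0//; apply/seteqP; split=> // x /AU[w].
    by rewrite G0.
  move: Adelta => /[swap] ->; rewrite lte_fin; lra.
have [M hM sM] := word_num_cover T (big_ball_cover r0 hc) m.
have M0 : (0 < size M)%N by rewrite sM N_gt0.
have c0 : (0 < (4 * #|I| * m * #|I| ^ m * #|I| ^ m)%:R :> R)%R.
  by rewrite ltr0n !muln_gt0 !expn_gt0 q_gt0 m0.
have [n0 hn0] := ln_le_sublinear c0 eta0.
have [|n [n0n Dn] hn] := hmu U (1 - delta)%R
  [set n | (maxn n0 1 <= n)%N /\ D n] oU Udelta.
  by exists (maxn n0 1).
move: n0n; rewrite geq_max => /andP[n0n np].
have [Y0 /(_ np) hYn] := hY n.
have half := empirical_half np Y0 d0 hn.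
have bound := word_num_coding m0 hG hM q_gt0 _ M0 Y0 hYn half.
have {bound}bound : (ln (N n)%:R <= (eta + (ln 2 / m%:R + ln K%:R / m%:R
    + 2 * delta * word_rate m)) * n%:R)%R.
  have := @ln_word_bound R (N n) (N m) K #|I| m n
    (Num.truncn (2 * delta * n%:R)) delta (N_gt0 n) (N_gt0 m) K0 q_gt0 m0 np.
  move=> h; rewrite mulrDl; apply: le_trans (h _ _) _.
  - by rewrite truncn_le// !mulr_ge0// ltW.
  - by rewrite -sG /N -sM; apply: bound; rewrite sG.
  - by rewrite lerD2r hn0.
have npos : (0 < n%:R :> R)%R by rewrite ltr0n.
have sK : (s <= ln K%:R / m%:R)%R.
  have : (word_rate n <= eta + (ln 2 / m%:R + ln K%:R / m%:R
    + 2 * delta * word_rate m))%R by rewrite /word_rate ler_pdivrMr.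
  have h1 : (2 * delta * word_rate m <= 2 * delta * (t + eta))%R.
    by rewrite ler_pM2l ?mulr_gt0.
  have h2 : (2 * delta * eta <= eta)%R by rewrite ger_pMl//; lra.
  move: Dn; rewrite /D/= /s; lra.
rewrite lee_fin -[leRHS]lnK ?posrE ?ltr0n// ler_expR.
by rewrite -ler_pdivlMr.
Unshelve. all: by end_near. Qed.

Lemma word_growth_le_katok (delta : R) : (0 < delta)%R -> (delta < 1 / 2)%R ->
  (1 - 2 * delta)%:E * word_growth <=
    ereal_sup [set katok_entropy T mu r delta | mu in invariant_prob T].
Proof.
move=> d0 d1; rewrite -(fineK word_growth_fin_num) -EFinM.
apply/lee_subgt0Pr => e e0.
have [|mu inv hmu] := @exists_katok_ge delta (e / 4)%R d0 d1; first by rewrite divr_gt0.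
apply: le_trans (ereal_sup_ubound _); last by exists mu.
by apply: le_trans hmu; rewrite -EFinB lee_fin mulrCA divff// mulr1.
Qed.

End lower.

(** * Comparison of scales and conclusion *)

Section scaling.
Variable R : realType.
Implicit Types (f g u : R -> \bar R).

Lemma limf_esupZl_ge (a : R) u (F : set_system R) : (0 < a)%R ->
  a%:E * limf_esup u F <= limf_esup (fun x => a%:E * u x) F.
Proof.
move=> a0; apply: le_ereal_inf_tmp => _ [A FA <-].
rewrite -lee_pdivlMl//.
apply: (@le_trans _ _ (ereal_sup (u @` A))).
  by apply: ereal_inf_lbound; exists A.
apply: ge_ereal_sup => _ [x Ax <-].
by rewrite lee_pdivlMl//; apply: ereal_sup_ubound; exists x.
Qed.

Lemma ln_scale_near (k eta : R) : (0 < k)%R -> (0 < eta)%R ->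
  \forall e \near 0^'+, (0 < e)%R /\ (0 < `|ln e|)%R /\ (0 < `|ln (k * e)|)%R /\
    (`|ln (k * e)| <= (1 + eta) * `|ln e|)%R.
Proof.
move=> k0 eta0; near=> e.
have e0 : (0 < e)%R by [].
have e1 : (e < 1)%R by near: e; exact: nbhs_right_lt.
have ke1 : (k * e < 1)%R.
  by rewrite -ltr_pdivlMl//; near: e; apply: nbhs_right_lt; rewrite mulr1 invr_gt0.
have eln : (e < expR (ln k / eta))%R.
  by near: e; apply: nbhs_right_lt; rewrite expR_gt0.
have lne0 : (ln e < 0)%R by rewrite ln_lt0// e0.
have lnke0 : (ln (k * e) < 0)%R by rewrite ln_lt0// mulr_gt0.
rewrite !normr_gt0 !lt_eqF// !ltr0_norm//; do 3 split => //.
have : (ln e <= ln k / eta)%R.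
  by rewrite -[leRHS]expRK ler_ln ?posrE ?expR_gt0// ltW.
rewrite ler_pdivlMr// lnM ?posrE//; lra.
Unshelve. all: by end_near. Qed.

Lemma near_right_scale (k : R) (A : set R) : (0 < k)%R ->
  (\forall e \near 0^'+, A e) -> \forall e \near (0 : R)^'+, A (k * e)%R.
Proof.
move=> k0 /nbhs_ballP[d /= d0 dA]; near=> e.
have e0 : (0 < e)%R by [].
apply: dA => /=; last by rewrite mulr_gt0.
rewrite /ball/= sub0r normrN gtr0_norm ?mulr_gt0//.
rewrite -ltr_pdivlMl//; near: e; apply: nbhs_right_lt.
by rewrite mulr_gt0// invr_gt0.
Unshelve. all: by end_near. Qed.

(** For every [eta > 0], [|ln (k e)| <= (1 + eta) |ln e|] as soon as [e] is
    small. *)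
Lemma limf_esup_ln_scale f g (k : R) : (0 < k)%R ->
  (forall e, (0 < e)%R -> 0 <= g e) ->
  (forall e, (0 < e)%R -> f e <= g (k * e)%R) ->
  limf_esup (fun e => f e / `|ln e|%:E) 0^'+ <=
  limf_esup (fun e => g e / `|ln e|%:E) 0^'+.
Proof.
move=> k0 g0 fg; set Lf := limf_esup _ _; set Lg := limf_esup _ _.
have main eta : (0 < eta)%R -> Lf <= (1 + eta)%:E * Lg.
  move=> eta0; have eta1 : (0 < 1 + eta)%R by rewrite addr_gt0.
  rewrite -lee_pdivrMl//; apply: le_ereal_inf_tmp => _ [A FA <-].
  rewrite lee_pdivrMl//; apply: limf_esup_le.
  have := near_right_scale k0 FA.
  have := ln_scale_near k0 eta0.
  apply: filterS2 => e [e0 [le0 [lke0 lle]]] Ake.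
  apply: (@le_trans _ _ ((1 + eta)%:E * (g (k * e)%R / `|ln (k * e)|%:E))); last first.
    apply: lee_wpmul2l; first by rewrite lee_fin ltW.
    by apply: ereal_sup_ubound; exists (k * e)%R.
  rewrite muleCA !inver !gt_eqF// -EFinM.
  apply: (@le_trans _ _ (g (k * e)%R * (`|ln e|^-1)%:E)).
    by apply: lee_wpmul2r; rewrite ?lee_fin ?invr_ge0// fg.
  apply: lee_wpmul2l; first by rewrite g0// mulr_gt0.
  by rewrite lee_fin ler_pdivlMr// mulrC ler_pdivrMr.
have Lg0 : 0 <= Lg.
  apply: limf_esup_ge; near=> e; rewrite mule_ge0//.
    by apply: g0; near: e; exact: nbhs_right_gt.
  by rewrite inve_ge0.
move: main Lg0; case: Lg => [l| |] main Lg0 //; last by rewrite leey.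
apply/lee_addgt0Pr => e e0.
have l0 : (0 <= l)%R by rewrite -lee_fin.
have l1 : (0 < l + 1)%R by rewrite ltr_wpDl.
apply: le_trans (main (e / (l + 1))%R _) _; first by rewrite divr_gt0.
rewrite -EFinM -EFinD lee_fin mulrDl mul1r lerD2l mulrAC ler_pdivrMr//.
by rewrite ler_pM2l// lerDl.
Unshelve. all: by end_near. Qed.

End scaling.

Section comparison.
Variables (R : realType) (X : pmetricType R) (T : X -> X).
Hypothesis cX : compact [set: X].
Hypothesis cT : continuous T.

Let katok_sup (delta e : R) : \bar R :=
  ereal_sup [set katok_entropy T mu e delta | mu in invariant_prob T].

Lemma sep_growth_ge0 (e : R) : 0 <= sep_growth T e.
Proof.
apply: limf_esup_ge; apply: nearW => n; apply: mule_ge0; rewrite ?lee_fin//.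
rewrite lne_ge0; apply: le_trans (ereal_sup_ubound _); last first.
  by exists [set point] => // x y -> ->.
by rewrite /counting; case: asboolP => // _; rewrite fset_set1 cardfs1.
Qed.

Lemma umdim_ge0 : 0 <= umdim T.
Proof.
apply: limf_esup_ge; apply: nearW => e; rewrite mule_ge0 ?sep_growth_ge0//.
by rewrite inve_ge0.
Qed.

Lemma limsup_katok_le (delta : R) : (0 < delta)%R ->
  limf_esup (fun e => katok_sup delta e / `|ln e|%:E) 0^'+ <= umdim T.
Proof.
move=> d0; apply: (@limf_esup_ln_scale _ _ _ 2^-1) => //.
- by move=> e _; exact: sep_growth_ge0.
- move=> e e0; apply: ge_ereal_sup => _ [mu _ <-].
  by rewrite mulrC; exact: katok_entropy_le.
Qed.

Lemma sep_growth_le_katok (delta e : R) :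
  (0 < delta)%R -> (delta < 1 / 2)%R -> (0 < e)%R ->
  (1 - 2 * delta)%:E * sep_growth T (4 * e)%R <= katok_sup delta e.
Proof.
move=> d0 d1 e0; have [I [c hc]] := finite_net cX e0.
apply: le_trans (word_growth_le_katok cX cT e0 hc d0 d1).
apply: lee_wpmul2l; first by rewrite lee_fin; lra.
exact: sep_growth_le.
Qed.

Lemma limsup_katok_ge (delta : R) : (0 < delta)%R -> (delta < 1 / 2)%R ->
  (1 - 2 * delta)%:E * umdim T <=
  limf_esup (fun e => katok_sup delta e / `|ln e|%:E) 0^'+.
Proof.
move=> d0 d1; have d2 : (0 < 1 - 2 * delta)%R by lra.
apply: (le_trans (limf_esupZl_ge _ _ d2)).
under [X in limf_esup X _]eq_fun do rewrite muleA.
apply: (@limf_esup_ln_scale _ _ _ 4^-1) => //.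
- move=> e e0; apply: le_trans (sep_growth_le_katok d0 d1 e0).
  by rewrite mule_ge0 ?sep_growth_ge0// lee_fin ltW.
- move=> e e0; rewrite -{1}[e](mulVKf (_ : 4 != 0))%R//.
  by apply: sep_growth_le_katok => //; rewrite mulr_gt0.
Qed.

End comparison.

Theorem theorem2 (R : realType) (X : pmetricType R) (T : X -> X)
    (hX : compact [set: X]) (hT : continuous T) :
  limf_esup
    (fun e : R =>
       ereal_sup [set katok_entropy T mu e delta | mu in invariant_prob T]
         / `|ln e|%:E)
    0^'+ @[delta --> (0 : R)^'+] --> umdim T.
Proof.
apply: (@squeeze_cvge _ _ _ _ (fun delta : R => (1 - 2 * delta)%:E * umdim T)
  _ (cst (umdim T))); last exact: cvg_cst.
- near=> delta; apply/andP; split.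
    by apply: limsup_katok_ge => //; near: delta; exact: nbhs_right_lt.
  by apply: limsup_katok_le.
- have := umdim_ge0 T; case: (umdim T) => [u| |] // _.
    under eq_fun do rewrite -EFinM.
    apply: cvg_EFin; first exact: nearW.
    rewrite -[X in _ --> X]mul1r; apply: cvgM; last exact: cvg_cst.
    rewrite -[X in _ --> X]subr0; apply: cvgB; first exact: cvg_cst.
    rewrite -[X in _ --> X](mulr0 (2%:R : R)%R); apply: cvgM; first exact: cvg_cst.
    exact: cvg_at_right_filter.
  apply: cvg_near_cst; near=> delta.
  rewrite gt0_muley// lte_fin subr_gt0 -ltr_pdivlMl// mulr1.
Unshelve. all: by end_near. Qed.
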